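(* In the Ising mixed $p$-spin model with parameters $(\xi,h)$, $\xi$ convex on $[-1,1]$: Generalized FEB holds if and only if there is some $q_0\in[-1,1]$ with $I(q_0)=0$ such that $I$ is not both non-increasing on $[-1,q_0]$ and non-decreasing on $[q_0,1]$.
   Context: **Model.** For $N\ge1$ let $\Sigma_N=\{-1,1\}^N$ and let $d\sigma$ be the uniform probability measure on $\Sigma_N$. Let $\xi(t)=\sum_{p\ge1}\beta_p^2t^p$ with $\xi(1+\epsilon)<\infty$ for some $\epsilon>0$, and $h\ge0$. $H_N$ is the Gaussian process on $\Sigma_N$ with $\mathbb{E}H_N(\sigma)=h\sum_i\sigma_i$ and $\mathrm{Cov}(H_N(\sigma^1),H_N(\sigma^2))=N\xi(R_{12})$, where $R_{12}=\frac1N\sum_i\sigma^1_i\sigma^2_i$. The Gibbs measure is $\pi_N(d\sigma)=e^{-H_N(\sigma)}d\sigma/Z_N$. **Generalized FEB.** Let $\mathcal H=\sup_{-1\le q_1<q_2<q_3\le1}\big(-I(q_1)+I(q_2)-I(q_3)\big)$. Generalized FEB holds if $\mathcal H>0$. Here $I:[-1,1]\to[0,\infty]$ is the rate function of the almost sure large deviation principle with speed $N$ for $\mathscr Q_N(\cdot)=\pi_N^{\otimes2}(R_{12}\in\cdot)$, given by $$I(q)=-\inf_{\lambda\in\mathbb R,\ Q\in\mathcal Q_q,\ \nu\in\Pr([0,1])}P(\nu,Q,\lambda)+2\min_{\nu\in\Pr([0,1])}P_I(\nu).$$ **Functional $P_I$.** For $\nu\in\Pr([0,1])$ let $\phi_\nu:[0,1]\times\mathbb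 R\to\mathbb R$ be the unique weak solution (continuous, with essentially bounded weak spatial derivative, equation in the distributional sense) of $\partial_t\phi_\nu+\frac{\xi''(t)}2(\partial_x^2\phi_\nu+\nu([0,t])(\partial_x\phi_\nu)^2)=0$, $\phi_\nu(1,x)=\log\cosh x$; then $P_I(\nu)=\phi_\nu(0,h)-\frac12\int_0^1\xi''(s)s\,\nu([0,s])ds$. **Functional $P$.** For $q\in[-1,1]$, $\mathcal Q_q$ is the set of continuous, weakly differentiable ($W^{1,1}$), non-decreasing (in the positive semidefinite order) paths $Q_t=(q_{ij}(t))_{i,j\le 2}$, $t\in[0,1]$, of $2\times2$ positive semidefinite matrices with $Q_0=0$ and $Q_1=\begin{pmatrix}1 & q \\ q & 1\end{pmatrix}$. Put $A(t)=\xi''(Q_t)\odot\dot Q_t$ ($\odot$ is the entrywise product, $\xi''$ applied entrywise). For $\lambda\in\mathbb R$ let $u$ be the weak solution on $[0,1]\times\mathbb R^2$ of $$\partial_tu+\tfrac12\big(\langle A,D^2u\rangle+\nu([0,t])\langle Du,A\,Du\rangle\big)=0,\qquad u(1,x)=\log\Big(\tfrac14\sum_{\epsilon_1,\epsilon_2\in\{\pm1\}}e^{\epsilon_1x_1+\epsilon_2x_2+\lambda\epsilon_1\epsilon_2}\Big)$$ (for degenerate $A$, $u$ is understood by continuous extension, i.e. as the limit $\delta\downarrow0$ of the solutions with $A+\delta\,\mathrm{Id}$). Then $$P(\nu,Q,\lambda)=u(0,(h,h))-\lambda q-\tfrac12\sum_{i,j}\int_0^1\nu([0,t])\,\xi''(q_{ij}(t))\,q_{ij}(t)\,\dot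 q_{ij}(t)\,dt .$$ *)

(* Defs.v *)
From HB Require Import structures.
From mathcomp Require Import all_boot all_order all_algebra.
From mathcomp Require Import all_classical all_reals all_analysis.

Set Implicit Arguments.
Unset Strict Implicit.
Unset Printing Implicit Defensive.

Import Order.TTheory GRing.Theory Num.Theory.
Import numFieldNormedType.Exports.

Local Open Scope classical_set_scope.
Local Open Scope ring_scope.

Section WeakDerivatives.
Context {R : realType}.

(* C^oo on a finite-dimensional space: every iterated directional derivative
   exists and is (Frechet) differentiable everywhere. *)
Definition smooth {V : normedModType R} (psi : V -> R) : Prop :=
  forall (vs : seq V) (z : V),
    differentiable (foldr (fun v f => 'D_v f) psi vs) z.

Definition test_function {V : normedModType R} (U : set V) (psi : V -> R) :
    Prop :=
  smooth psi /\
  exists K : set V, [/\ compact K, K `<=` U & forall z, ~ K z -> psi z = 0].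

(* [g] is the distributional derivative of [f] on the open set [U] in the
   direction [v].  [J] stands for Lebesgue integration over the whole of [V];
   the integrands vanish outside the support of [psi]. *)
Definition weak_derivative {V : normedModType R} (J : (V -> R) -> R)
    (U : set V) (v : V) (f g : V -> R) : Prop :=
  forall psi, test_function U psi ->
    J (fun z => f z * 'D_v psi z) = - J (fun z => g z * psi z).

Definition leb1 : {sigma_finite_measure set (measurableTypeR R) -> \bar R} :=
  @lebesgue_measure R.
Definition leb2 :
    {measure set (measurableTypeR R * measurableTypeR R)%type -> \bar R} :=
  (leb1 \x leb1)%E.
(* [\x^] is the product measure computed by integrating the measures of the
   sections over the second factor; it only needs its first factor to be
   sigma-finite. *)
Definition leb3 :
    {measure set (measurableTypeR R * (measurableTypeR R * measurableTypeR R))%type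
       -> \bar R} :=
  (leb1 \x^ leb2)%E.

Definition int1 (f : R -> R) : R := \int[leb1]_t f t.
Definition int2 (f : R * R -> R) : R := \int[leb2]_z f z.
Definition int3 (f : R * (R * R) -> R) : R := \int[leb3]_z f z.

End WeakDerivatives.

Section Model.
Context {R : realType}.

Definition slab {X : Type} : set (R * X) := [set z | 0 < z.1 < 1].
Definition closed_slab {X : Type} : set (R * X) := [set z | 0 <= z.1 <= 1].

Definition dt1 : R * R := (1, 0).
Definition dx1 : R * R := (0, 1).
Definition dt2 : R * (R * R) := (1, (0, 0)).
Definition dx2 (i : 'I_2) : R * (R * R) :=
  (0, if i == 0 then (1, 0) else (0, 1)).

Definition second_derivative (f : R -> R) : R -> R := (f^`(2))%classic.

Variables (xi : R -> R) (h : R).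

Local Notation xi2 := (second_derivative xi).

Definition is_Pr01 (nu : probability (measurableTypeR R) R) : Prop :=
  nu `[0, 1]%classic = 1%E.

Definition cdf01 (nu : probability (measurableTypeR R) R) (t : R) : R :=
  fine (nu `[0, t]%classic).

Definition cosh (x : R) : R := (expR x + expR (- x)) / 2.

Definition parisi_solution (nu : probability (measurableTypeR R) R)
    (phi : R * R -> R) : Prop :=
  [/\ {within closed_slab, continuous phi},
      forall x, phi (1, x) = ln (cosh x) &
      exists p : R * R -> R,
      [/\ measurable_fun slab p,
          exists C : R, {ae leb2, forall z, slab z -> `|p z| <= C},
          weak_derivative int2 slab dx1 phi p &
          forall psi, test_function slab psi ->
            int2 (fun z => - (phi z * 'D_dt1 psi z)
              + xi2 z.1 / 2 * (phi z * 'D_dx1 ('D_dx1 psi) z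
                               + cdf01 nu z.1 * p z ^+ 2 * psi z)) = 0]].

Definition parisi_phi nu : R * R -> R := [get phi | parisi_solution nu phi].

Definition P_I nu : R :=
  parisi_phi nu (0, h)
  - 2^-1 * \int[leb1]_(s in `[0, 1]) (xi2 s * s * cdf01 nu s).

Definition psd (M : 'M[R]_2) : Prop :=
  M^T = M /\ forall x : 'rV[R]_2, 0 <= (x *m M *m x^T) 0 0.

Definition posdef (M : 'M[R]_2) : Prop :=
  M^T = M /\ forall x : 'rV[R]_2, x != 0 -> 0 < (x *m M *m x^T) 0 0.

Definition is_W11_derivative (f g : R -> R) : Prop :=
  leb1.-integrable `]0, 1[ (EFin \o g) /\
  weak_derivative int1 `]0, 1[ 1 f g.

Definition wderiv (f : R -> R) : R -> R := [get g | is_W11_derivative f g].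

Definition entry (Q : R -> 'M[R]_2) (i j : 'I_2) : R -> R := fun t => Q t i j.

Definition admissible_path (q : R) (Q : R -> 'M[R]_2) : Prop :=
  [/\ forall i j, {within `[0, 1], continuous (entry Q i j)},
      forall i j, exists g, is_W11_derivative (entry Q i j) g,
      forall t, 0 <= t <= 1 -> psd (Q t),
      forall s t, 0 <= s -> s <= t -> t <= 1 -> psd (Q t - Q s) &
      Q 0 = 0 /\ Q 1 = \matrix_(i, j) (if i == j then 1 else q)].

Definition path_coef (Q : R -> 'M[R]_2) (t : R) : 'M[R]_2 :=
  \matrix_(i, j) (xi2 (Q t i j) * wderiv (entry Q i j) t).

Definition terminal2 (lambda : R) (x : R * R) : R :=
  ln (4^-1 * \sum_(e1 : bool) \sum_(e2 : bool)
        expR ((-1) ^+ e1 * x.1 + (-1) ^+ e2 * x.2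
              + lambda * (-1) ^+ e1 * (-1) ^+ e2)).

Definition parabolic_solution (nu : probability (measurableTypeR R) R)
    (A : R -> 'M[R]_2) (g : R * R -> R) (u : R * (R * R) -> R) : Prop :=
  [/\ {within closed_slab, continuous u},
      forall x, u (1, x) = g x &
      exists p : 'I_2 -> R * (R * R) -> R,
      [/\ forall i, measurable_fun slab (p i),
          exists C : R, forall i,
            {ae leb3, forall z, slab z -> `|p i z| <= C},
          forall i, weak_derivative int3 slab (dx2 i) u (p i) &
          forall psi, test_function slab psi ->
            int3 (fun z => - (u z * 'D_dt2 psi z)
              + 2^-1 * ((\sum_i \sum_j
                           A z.1 i j * u z * 'D_(dx2 i) ('D_(dx2 j) psi) z)
                        + cdf01 nu z.1
                          * (\sum_i \sum_j p i z * A z.1 i j * p j z)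
                          * psi z)) = 0]].

Definition weak_u nu A g : R * (R * R) -> R :=
  [get u | parabolic_solution nu A g u].

Definition nondegenerate (A : R -> 'M[R]_2) : Prop :=
  {ae leb1, forall t, 0 < t < 1 -> posdef (A t)}.

Definition pair_u nu A g (z : R * (R * R)) : R :=
  if pselect (nondegenerate A) then weak_u nu A g z
  else lim (weak_u nu (fun t => A t + delta%:M) g z @[delta --> 0^'+]).

Definition P_pair nu (Q : R -> 'M[R]_2) (lambda q : R) : R :=
  pair_u nu (path_coef Q) (terminal2 lambda) (0, (h, h))
  - lambda * q
  - 2^-1 * \sum_i \sum_j \int[leb1]_(t in `[0, 1])
      (cdf01 nu t * xi2 (Q t i j) * Q t i j * wderiv (entry Q i j) t).

(* The minimum of [P_I] is written as an infimum. *)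
Definition rate_formula (q : R) : \bar R :=
  (- ereal_inf [set y | exists lambda Q nu,
        [/\ admissible_path q Q, is_Pr01 nu & y = (P_pair nu Q lambda q)%:E]]
   + 2%:E * ereal_inf [set (P_I nu)%:E | nu in is_Pr01])%E.

End Model.

Section Ising.
Context {R : realType}.

Definition mixture (beta : nat -> R) (t : R) : R :=
  limn (series (fun k => beta k.+1 ^+ 2 * t ^+ k.+1)).

Definition mixture_converges (beta : nat -> R) (t : R) : Prop :=
  cvgn (series (fun k => beta k.+1 ^+ 2 * t ^+ k.+1)).

Definition conf (N : nat) := {ffun 'I_N -> bool}.

Definition spin {N} (s : conf N) (i : 'I_N) : R := (-1) ^+ s i.

Definition overlap {N} (s1 s2 : conf N) : R :=
  N%:R^-1 * \sum_(i < N) spin s1 i * spin s2 i.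

Context d (Omega : measurableType d) (P : probability Omega R).

(* Degenerate (constant) normal variables are allowed; [normal_prob m 0] is not
   a Dirac mass in the library. *)
Definition gaussian_variable (X : Omega -> R) : Prop :=
  exists m s : R, forall B : set R, measurable B ->
    P (X @^-1` B) = if s == 0 then \d_m B else normal_prob m s B.

Definition gaussian_process {I : finType} (X : I -> {RV P >-> R}) : Prop :=
  forall a : I -> R, gaussian_variable (fun w => \sum_i a i * X i w).

Definition is_hamiltonian (xi : R -> R) (h : R) (N : nat)
    (H : conf N -> {RV P >-> R}) : Prop :=
  [/\ gaussian_process H,
      forall s, ('E_P[H s] = (h * \sum_(i < N) spin s i)%:E)%E &
      forall s1 s2, covariance P (H s1) (H s2)
                    = (N%:R * xi (overlap s1 s2))%:E].

Definition partition_function {N} (H : conf N -> {RV P >-> R}) (w : Omega) : R :=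
  \sum_(s : conf N) (2 ^+ N)^-1 * expR (- H s w).

Definition gibbs {N} (H : conf N -> {RV P >-> R}) (w : Omega) (s : conf N) : R :=
  (2 ^+ N)^-1 * expR (- H s w) / partition_function H w.

Definition overlap_law {N} (H : conf N -> {RV P >-> R}) (w : Omega)
    (B : set R) : R :=
  \sum_(s1 : conf N) \sum_(s2 : conf N)
     gibbs H w s1 * gibbs H w s2 * \1_B (overlap s1 s2).

Definition overlap_range : set R := `[-1, 1].

Definition rate_function (I : R -> \bar R) : Prop :=
  (forall q, -1 <= q <= 1 -> (0 <= I q)%E) /\
  lower_semicontinuous (I : subspace overlap_range -> \bar R).

(* Large deviation principle on [-1, 1] with speed N: closed and open subsets
   of [-1, 1] are the traces of closed and open subsets of the line. *)
Definition LDP (mu : nat -> set R -> R) (I : R -> \bar R) : Prop :=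
  [/\ rate_function I,
      forall F : set R, closed F ->
        (limn_esup (fun N => N%:R^-1%:E * lne (mu N (F `&` overlap_range))%:E)
         <= - ereal_inf [set I q | q in F `&` overlap_range])%E &
      forall G : set R, open G ->
        (- ereal_inf [set I q | q in G `&` overlap_range]
         <= limn_einf (fun N => N%:R^-1%:E * lne (mu N (G `&` overlap_range))%:E))%E].

Definition almost_sure_LDP (H : forall N, conf N -> {RV P >-> R})
    (I : R -> \bar R) : Prop :=
  {ae P, forall w, LDP (fun N => overlap_law (H N) w) I}.

End Ising.

Section FEB.
Context {R : realType}.

(* In [\bar R] one has [+oo - +oo = -oo], so triples at which [I q1] or [I q3]
   is infinite contribute [-oo]. *)
Definition FEB_barrier (I : R -> \bar R) : \bar R :=
  ereal_sup [set y | exists q1 q2 q3 : R,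
    [/\ -1 <= q1, q1 < q2, q2 < q3, q3 <= 1 &
        y = (- I q1 + I q2 - I q3)%E]].

Definition generalized_FEB (I : R -> \bar R) : Prop :=
  (0 < FEB_barrier I)%E.

Definition nonincreasing_on (a b : R) (I : R -> \bar R) : Prop :=
  forall x y, a <= x -> x <= y -> y <= b -> (I y <= I x)%E.

Definition nondecreasing_on (a b : R) (I : R -> \bar R) : Prop :=
  forall x y, a <= x -> x <= y -> y <= b -> (I x <= I y)%E.

End FEB.

(* Main.v *)
Require Import Defs.
From mathcomp Require Import all_boot all_order all_algebra.
From mathcomp Require Import all_classical all_reals all_analysis.

Import Order.TTheory GRing.Theory Num.Theory.
Import numFieldNormedType.Exports.

Local Open Scope classical_set_scope.
Local Open Scope ring_scope.

(** Overlaps lie in [-1, 1], so the upper bound of the LDP for the whole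
    interval gives inf I <= 0; as I is nonnegative and lower semicontinuous on a
    compact interval, I vanishes at some q.  The barrier is positive iff
    I q1 + I q3 < I q2 for some q1 < q2 < q3.  Given such a triple, monotonicity
    of I on the side of q containing q2 would bound I q2 by I q1 or I q3.
    Conversely, a failure of monotonicity on one side of a zero q0 gives two
    points which form such a triple with q0. *)

(** Each point of [K] has a neighbourhood on which [f] exceeds some real above [a]; compactness
    makes a single real [b > a] work on all of [K], so the infimum is at least [b]. *)
Lemma compact_lsc_lt_ereal_inf (T : topologicalType) (R : realType)
  (K : set T) (f : T -> \bar R) (a : R) :
  compact K -> lower_semicontinuous (f : subspace K -> \bar R) ->
  (forall x, K x -> (a%:E < f x)%E) -> (a%:E < ereal_inf (f @` K))%E.
Proof.
move=> /compact_near_coveringP/near_covering_withinP cK lscf fgt.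
(* Compactness, used as near-covering, exchanges the quantifiers over [x] in [K] and over [b] close
   to [a] from the right. *)
have near_lt : \forall b \near a^'+, K `<=` (fun x => b%:E < f x)%E.
  apply: cK => x Kx.
  have [b ab bf] : exists2 b : R, a < b & (b%:E < f x)%E.
    have := fgt x Kx; case: (f x) => [r| |] //.
      rewrite lte_fin => ar; exists ((a + r) / 2); rewrite ?lte_fin.
        by rewrite midf_lt.
      by rewrite midf_lt.
    by move=> _; exists (a + 1); rewrite ?ltey // ltrDl.
  have [V nV Vf] := lscf x b bf.
  (* [V] is a neighbourhood only relative to [K]; the implication turns it into one in [T]. *)
  exists ([set y | K y -> V y], [set c | c <= b]) => /=.
    split; last by apply: nbhs_right_le.
    by move: nV; rewrite /nbhs /= -nbhs_subspace_in.
  move=> [y c] /= [KV cb] Ky; apply: le_lt_trans (Vf y (KV Ky)).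
  by rewrite lee_fin.
have [b [Kb ab]] : exists b, K `<=` (fun x => b%:E < f x)%E /\ a < b.
  apply: (@filter_ex _ a^'+).
  by apply: filterI near_lt _; exact: nbhs_right_gt.
apply: (@lt_le_trans _ _ b%:E); first by rewrite lte_fin.
by apply: le_ereal_inf_tmp => _ [x Kx <-]; exact: ltW (Kb x Kx).
Qed.

Lemma overlap_in_range (R : realType) (N : nat) (s1 s2 : conf N) :
  overlap_range (overlap s1 s2 : R).
Proof.
rewrite /overlap_range /= in_itv /= -ler_norml /overlap normrM.
rewrite (ger0_norm (_ : 0 <= N%:R^-1)) ?invr_ge0 //.
have sum_le : `|\sum_(i < N) (spin s1 i * spin s2 i : R)| <= N%:R.
  apply: le_trans (ler_norm_sum _ _ _) _.
  rewrite -[X in _ <= X%:R]card_ord -sumr_const ler_sum // => i _.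
  by rewrite normrM /spin !normrX normrN1 !expr1n mulr1.
(* For [N = 0] the convention that the inverse of 0 is 0 makes the overlap 0. *)
case: N s1 s2 sum_le => [|N] s1 s2 sum_le; first by rewrite invr0 mul0r.
by rewrite mulrC ler_pdivrMr ?mul1r ?ltr0n.
Qed.

Section OverlapLaw.
Context (R : realType) (d : measure_display) (Omega : measurableType d).
Context (P : probability Omega R) (N : nat) (H : conf N -> {RV P >-> R}).

Lemma gibbs_sum (w : Omega) : \sum_s gibbs H w s = 1.
Proof.
rewrite /gibbs -mulr_suml divff // gt_eqF // /partition_function.
have pos (s : conf N) : 0 < (2 ^+ N)^-1 * expR (- H s w) :> R.
  by rewrite mulr_gt0 ?expR_gt0 // invr_gt0 exprn_gt0.
(* Splitting off one configuration shows that the sum is not empty, hence strictly positive. *)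
by rewrite (bigD1 [ffun=> true]) //= ltr_pwDl ?sumr_ge0 //.
Qed.

Lemma overlap_law_range (w : Omega) : overlap_law H w overlap_range = 1.
Proof.
rewrite /overlap_law -[RHS](gibbs_sum w); apply: eq_bigr => s1 _.
rewrite -[RHS]mulr1 -(gibbs_sum w) mulr_sumr; apply: eq_bigr => s2 _.
by rewrite indicE mem_set ?mulr1 //; exact: overlap_in_range.
Qed.

End OverlapLaw.

Lemma LDP_rate_zero (R : realType) (mu : nat -> set R -> R) (I : R -> \bar R) :
  (forall N, mu N overlap_range = 1) -> LDP mu I ->
  exists2 q, -1 <= q <= 1 & I q = 0%E.
Proof.
move=> mu1 [[I_ge0 lscI] /(_ setT closedT) upper _].
have infI_le0 : (ereal_inf [set I q | q in overlap_range] <= 0)%E.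
  (* The whole interval has mass 1, so the sequence in the upper bound is constantly 0. *)
  move: upper; under eq_fun do rewrite setTI mu1 lne1 mule0.
  rewrite is_cvg_limn_esupE; last exact: is_cvg_cst.
  rewrite lim_cst; last exact: ereal_hausdorff.
  by rewrite setTI leeNr oppe0.
apply: contrapT => noI0.
suff : (0%:E < ereal_inf [set I q | q in overlap_range])%E.
  by rewrite ltNge infI_le0.
apply: compact_lsc_lt_ereal_inf lscI _; first exact: segment_compact.
move=> q; rewrite /overlap_range /= in_itv /= => q11.
rewrite lt_neqAle I_ge0 // andbT; apply/eqP => Iq0.
by apply: noI0; exists q.
Qed.

Section Barrier.
Context (R : realType) (I : R -> \bar R).
Context (I_ge0 : forall q, -1 <= q <= 1 -> (0 <= I q)%E).

Lemma generalized_FEBP : generalized_FEB I <->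
  exists q1 q2 q3 : R, [/\ -1 <= q1, q1 < q2, q2 < q3, q3 <= 1 &
    (I q1 + I q3 < I q2)%E].
Proof.
(* Nonnegativity rules out the value [-oo]. If [I q1] or [I q3] is [+oo], both inequalities are
   false; if only [I q2] is, both are true. *)
have barrierE (q1 q2 q3 : R) : -1 <= q1 -> q1 < q2 -> q2 < q3 -> q3 <= 1 ->
    (0 < - I q1 + I q2 - I q3)%E = (I q1 + I q3 < I q2)%E.
  move=> ge1 lt12 lt23 le1.
  have gt2 := le_lt_trans ge1 lt12.
  have lt2 := lt_le_trans lt23 le1.
  have : (0 <= I q1)%E by rewrite I_ge0 // ge1 ltW // (lt_trans lt12).
  have : (0 <= I q2)%E by rewrite I_ge0 // !ltW.
  have : (0 <= I q3)%E by rewrite I_ge0 // le1 andbT ltW // (lt_trans gt2).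
  case: (I q1) => [r1| |] //; case: (I q2) => [r2| |] //;
    case: (I q3) => [r3| |] //= _ _ _.
    by rewrite !lte_fin subr_gt0 [X in _ < X]addrC ltrBrDl.
  by rewrite -EFinD !ltry.
split.
  case/ereal_sup_gt => _ [q1 [q2 [q3 [ge1 lt12 lt23 le1 ->]]]] gt0.
  by exists q1, q2, q3; split=> //; rewrite -barrierE.
move=> [q1 [q2 [q3 [ge1 lt12 lt23 le1 lt2]]]].
apply: (@lt_le_trans _ _ (- I q1 + I q2 - I q3)%E); first by rewrite barrierE.
by apply: ereal_sup_ubound; exists q1, q2, q3.
Qed.

Lemma generalized_FEB_not_monotone : (exists2 q, -1 <= q <= 1 & I q = 0%E) ->
  generalized_FEB I <->
  exists q0 : R, [/\ -1 <= q0 <= 1, I q0 = 0%E &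
    ~ (nonincreasing_on (-1) q0 I /\ nondecreasing_on q0 1 I)].
Proof.
move=> [q q11 Iq0]; split.
  move=> /generalized_FEBP [q1 [q2 [q3 [ge1 lt12 lt23 le1 lt2]]]].
  exists q; split=> // -[noninc nondec].
  have q1_ge0 : (0 <= I q1)%E.
    by rewrite I_ge0 // ge1 (le_trans _ le1) // ltW // (lt_trans lt12).
  have q3_ge0 : (0 <= I q3)%E.
    by rewrite I_ge0 // le1 (le_trans ge1) // ltW // (lt_trans lt12).
  have [q2q|qq2] := leP q2 q.
    have := noninc q1 q2 ge1 (ltW lt12) q2q.
    by rewrite leNgt (le_lt_trans _ lt2) // leeDl.
  have := nondec q2 q3 (ltW qq2) (ltW lt23) le1.
  by rewrite leNgt (le_lt_trans _ lt2) // leeDr.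
(* In either case monotonicity fails at some [x <= y], and [x < y] since the violating inequality is
   strict. *)
move=> [q0 [/andP[q0_ge q0_le] Iq00]] /not_andP[] mono;
  apply: contrapT => noFEB; apply: mono => x y x_ge xy y_le;
  rewrite leNgt; apply/negP => Ilt; apply: noFEB; apply/generalized_FEBP;
  (have lt_xy : x < y by rewrite lt_neqAle xy andbT; apply: contraTneq Ilt => ->;
    rewrite ltxx).
- exists x, y, q0; split=> //; last by rewrite Iq00 adde0.
  (* If [y = q0], the violation [I x < I y] would read [I x < 0]. *)
  rewrite lt_neqAle y_le andbT; apply/eqP => yq0.
  move: Ilt; rewrite yq0 Iq00 ltNge I_ge0 // x_ge.
  by rewrite (le_trans xy) // yq0.
- exists q0, x, y; split=> //; last by rewrite Iq00 add0e.
  rewrite lt_neqAle x_ge andbT; apply/eqP => q0x.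
  move: Ilt; rewrite -q0x Iq00 ltNge I_ge0 // y_le andbT.
  by rewrite (le_trans q0_ge) // q0x.
Qed.

End Barrier.

Theorem proposition1p17 (R : realType)
  (beta : nat -> R)
  (beta_cvg : exists2 eps : R, 0 < eps & mixture_converges beta (1 + eps))
  (xi_convex : convex_function (`[-1, 1] : set R^o) (mixture beta))
  (h : R) (h_ge0 : 0 <= h)
  (d : measure_display) (Omega : measurableType d) (P : probability Omega R)
  (H : forall N : nat, conf N -> {RV P >-> R})
  (H_model : forall N : nat, (0 < N)%N ->
     is_hamiltonian (mixture beta) h (H N))
  (I : R -> \bar R)
  (I_LDP : almost_sure_LDP H I)
  (I_formula : forall q : R, -1 <= q <= 1 ->
     I q = rate_formula (mixture beta) h q) :
  generalized_FEB I <->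
  exists q0 : R, [/\ -1 <= q0 <= 1, I q0 = 0%E &
    ~ (nonincreasing_on (-1) q0 I /\ nondecreasing_on q0 1 I)].
Proof.
(* [I] does not depend on [w], so one realization satisfying the LDP is enough; it exists because
   [P] has positive total mass. *)
have [w I_LDPw] : exists w, LDP (fun N => overlap_law (H N) w) I.
  have PT_gt0 : (0 < P setT)%E by rewrite probability_setT lte01.
  have ae_proper := ae_properfilter_algebraOfSetsType PT_gt0.
  exact: filter_ex I_LDP.
have [[I_ge0 _] _ _] := I_LDPw.
apply: generalized_FEB_not_monotone => //.
by apply: LDP_rate_zero I_LDPw => N; exact: overlap_law_range.
Qed.
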